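(* Let $b=(b_0,b_1,\ldots)$ and $\lambda=(\lambda_0,\lambda_1,\ldots)$ be the sequences with $b_0=\lambda_0=1$ and, for $n\geq1$, \[ b_n = 3-\frac{1}{F_{2n-1}F_{2n-3}}, \qquad \lambda_n = 1+\frac{1}{F_{2n-1}^2}, \] where $F_m$ are the Fibonacci numbers ($F_0=0$, $F_1=1$, $F_m=F_{m-1}+F_{m-2}$ for all integers $m$, so $F_{-1}=1$). Then for every $n\geq 0$, \[ \#\mathrm{NC}_2(n) = \mathrm{Mot}_n(b,\lambda). \]
   Context: A Motzkin path of length $n$ is a lattice path from $(0,0)$ to $(n,0)$ with steps $U=(1,1)$, $D=(1,-1)$, $H=(1,0)$ never going below the $x$-axis. The height of a step is the $y$-coordinate of its ending point. Given sequences $b=(b_0,b_1,\ldots)$ and $\lambda=(\lambda_0,\lambda_1,\ldots)$, the weight of a Motzkin path is the product of $b_i$ over its horizontal steps of height $i$ and $\lambda_i$ over its down steps of height $i$ (up steps have weight $1$); $\mathrm{Mot}_n(b,\lambda)$ is the sum of weights of all Motzkin paths of length $n$. For a set partition of $[n]=\{1,\ldots,n\}$, an arc is a pair $(i,j)$ with $i<j$ in the same block such that the block contains no integer strictly between $i$ and $j$. A $2$-distant noncrossing partition of $[n]$ is a set partition of $[n]$ having no two arcs $(a,c)$ and $(b,d)$ with $a<b\leq c<d$ and $c-b\geq 2$. $\mathrm{NC}_2(n)$ denotes the set of $2$-distant noncrossing partitions of $[n]$. *)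

(* Defs.v *)
From HB Require Import structures.
From mathcomp Require Import all_boot all_order all_algebra.
From mathcomp Require Import ring zify.
Set Implicit Arguments.
Unset Strict Implicit.
Unset Printing Implicit Defensive.
Import Order.TTheory GRing.Theory Num.Theory.
Local Open Scope ring_scope.

Fixpoint fib (n : nat) : nat :=
  match n with
  | 0 => 0
  | S m => match m with 0 => 1 | S k => (fib m + fib k)%N end
  end.

(* F_(-n) = (-1)^(n+1) F_n, and Negz n is -(n+1). *)
Definition fibz (m : int) : int :=
  match m with
  | Posz n => (fib n)%:Z
  | Negz n => (-1) ^+ n * (fib n.+1)%:Z
  end.

Lemma fibz_rec (m : int) : fibz m = fibz (m - 1) + fibz (m - 2).
Proof.
have fibSS k : (fib k.+2)%:Z = (fib k.+1)%:Z + (fib k)%:Z by rewrite -PoszD.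
case: m => [[|[|n]]|n].
- by [].
- by [].
- have -> : Posz n.+2 - 1 = Posz n.+1 by rewrite -addn1 PoszD addrK.
  have -> : Posz n.+2 - 2 = Posz n by rewrite -addn2 PoszD addrK.
  exact: fibSS.
- have -> : Negz n - 1 = Negz n.+1 by rewrite !NegzE; lia.
  have -> : Negz n - 2 = Negz n.+2 by rewrite !NegzE; lia.
  by rewrite /fibz (fibSS n.+1) !exprS; ring.
Qed.

Inductive step := Up | Down | Horiz.

Definition step_code (s : step) : 'I_3 :=
  match s with Up => inord 0 | Down => inord 1 | Horiz => inord 2 end.

Definition step_decode (i : 'I_3) : step :=
  match val i with 0 => Up | 1 => Down | _ => Horiz end.

Lemma step_codeK : cancel step_code step_decode.
Proof. by case; rewrite /step_decode /= inordK. Qed.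

HB.instance Definition _ := Finite.copy step (can_type step_codeK).

Definition dy (s : step) : int :=
  match s with Up => 1 | Down => -1 | Horiz => 0 end.

(* y-coordinate of the point reached after the first k steps of p *)
Definition ycoord (p : seq step) (k : nat) : int :=
  \sum_(s <- take k p) dy s.

Definition is_motzkin (n : nat) (p : n.-tuple step) : bool :=
  [forall k : 'I_n.+1, 0 <= ycoord p k] && (ycoord p n == 0).

Definition motzkin_paths (n : nat) : {set n.-tuple step} :=
  [set p | is_motzkin p].

(* The absolute value only turns the height into an index; heights are
   nonnegative on Motzkin paths. *)
Definition step_height (n : nat) (p : n.-tuple step) (i : 'I_n) : nat :=
  `|ycoord p i.+1|%N.

Definition path_weight (R : comNzRingType) (b lambda : nat -> R) (n : nat)
    (p : n.-tuple step) : R :=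
  \prod_(i < n) match tnth p i with
                | Up => 1
                | Down => lambda (step_height p i)
                | Horiz => b (step_height p i)
                end.

Definition Mot (R : comNzRingType) (b lambda : nat -> R) (n : nat) : R :=
  \sum_(p in motzkin_paths n) path_weight b lambda p.

(* The ground set {1, ..., n} is encoded as 'I_n = {0, ..., n-1}; arcs and
   the 2-distant condition are invariant under this shift. *)
Definition arc (n : nat) (P : {set {set 'I_n}}) (i j : 'I_n) : bool :=
  (i < j)%N &&
  [exists B in P,
    [&& i \in B, j \in B & [forall k in B, ~~ ((i < k)%N && (k < j)%N)]]].

Definition noncrossing2 (n : nat) (P : {set {set 'I_n}}) : bool :=
  ~~ [exists a : 'I_n, exists b : 'I_n, exists c : 'I_n, exists d : 'I_n,
       [&& arc P a c, arc P b d, (a < b)%N, (b <= c)%N, (c < d)%N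
         & (2 <= c - b)%N]].

Definition NC2 (n : nat) : {set {set {set 'I_n}}} :=
  [set P | partition P [set: 'I_n] && noncrossing2 P].

(* Main.v *)
Require Import Defs.
From mathcomp Require Import all_boot all_order all_algebra.
From mathcomp Require Import ring lra zify.
Import Order.TTheory GRing.Theory Num.Theory.
Local Open Scope ring_scope.

(** A 2-distant noncrossing partition is read from left to right, each position
    naming its predecessor in its block. The admissible continuations depend
    only on the number [j + 1] of positions that may still be named, and the
    numbers [U_m(j)] of continuations by [m] positions satisfy
    [U_(m+1)(j) = U_m(j+1) + U_m(j) + \sum_(i < j) U_m(i+1)]. The binomial
    transform conjugates this recursion to the tridiagonal operator [K] with
    diagonal (2, 3, 3, ...) and off-diagonals 1, so [#NC_2(n+1)] is the
    [(0, 0)] entry of [K^n]. On the other side [Mot_n] is the [(0, 0)] entry of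
    [J^n] for the tridiagonal operator [J] with diagonal [b] and lower
    off-diagonal [lambda]. With [A] lower bidiagonal, of entries 1 and
    [F_(2i+1) / F_(2i-1)], one has [J A = A K] and [J e_0 = A e_0], hence the
    [(0, 0)] entries of [J^(n+1)] and [K^n] agree. *)

Set Implicit Arguments.
Unset Strict Implicit.
Unset Printing Implicit Defensive.

(** * Motzkin weights as entries of powers of a tridiagonal operator *)

Lemma sum_tuple_cons (V : nmodType) (T : finType) (n : nat) (F : seq T -> V) :
  \sum_(t : n.+1.-tuple T) F t = \sum_(a : T) \sum_(t : n.-tuple T) F (a :: t).
Proof.
rewrite pair_big /=.
rewrite (reindex (fun p : T * n.-tuple T => [tuple of p.1 :: p.2])) //=.
exists (fun t => (thead t, [tuple of behead t])) => [[a t]|t] _ //=.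
  by congr pair; apply: val_inj.
by apply: val_inj; rewrite /= [in RHS](tuple_eta t).
Qed.

(** Row [i] lists the first steps from height [i]: up, horizontal, down. A down step is weighted by
    the height it reaches, hence [l j]. *)
Definition jacobi (R : nzRingType) (b l v : nat -> R) (i : nat) : R :=
  v i.+1 + b i * v i + (if i is j.+1 then l j * v j else 0).

Definition unit0 (R : nzRingType) (i : nat) : R := (i == 0%N)%:R.

Section MotzkinJacobi.
Variables (R : comNzRingType) (b l : nat -> R).

(** A path leaving height [h] gets value 0 once it dips below the axis or ends off it, so sums can
    run over all step sequences. *)
Fixpoint weight_from (h : nat) (p : seq step) : R :=
  match p with
  | [::] => unit0 R h
  | Up :: q => weight_from h.+1 q
  | Down :: q => if h is k.+1 then l k * weight_from k q else 0
  | Horiz :: q => b h * weight_from h q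
  end.

Lemma enum_step_sum (V : nmodType) (F : step -> V) :
  \sum_s F s = F Up + F Horiz + F Down.
Proof.
rewrite (reindex step_decode) /=; last first.
  exists step_code => x _; last exact: step_codeK.
  by apply: val_inj; case: x => [[|[|[]]] //= lt]; rewrite inordK.
by rewrite !big_ord_recl big_ord0 /step_decode /= addr0 addrA addrAC.
Qed.

Lemma sum_weight_from n h :
  \sum_(p : n.-tuple step) weight_from h p = iter n (jacobi b l) (unit0 R) h.
Proof.
elim: n h => [|n IHn] h.
  rewrite (eq_bigr (fun=> unit0 R h)) => [|p _]; last by rewrite tuple0.
  by rewrite sumr_const card_tuple expn0.
rewrite (sum_tuple_cons _ (weight_from h)) enum_step_sum /= /jacobi.
rewrite -mulr_sumr !IHn; congr (_ + _).
by case: h => [|h]; [rewrite big1|rewrite -mulr_sumr IHn].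
Qed.

Lemma ycoord_cons s p k : ycoord (s :: p) k.+1 = dy s + ycoord p k.
Proof. by rewrite /ycoord /= big_cons. Qed.

Lemma ycoord0 p : ycoord p 0 = 0.
Proof. by rewrite /ycoord take0 big_nil. Qed.

Definition stays_nonneg (h : nat) (p : seq step) : bool :=
  all (fun k => 0 <= h%:Z + ycoord p k) (iota 0 (size p).+1).

Lemma stays_nonneg_cons h k s p : h%:Z + dy s = k%:Z ->
  stays_nonneg h (s :: p) = stays_nonneg k p.
Proof.
move=> e; rewrite /stays_nonneg.
rewrite (_ : iota 0 (size (s :: p)).+1 = 0%N :: map S (iota 0 (size p).+1)); last first.
  by rewrite -(iotaDl 1 0).
move: (iota 0 (size p).+1) => r; rewrite /= ycoord0 addr0 lez_nat leq0n all_map /=.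
apply: eq_all => i /=.
by rewrite ycoord_cons addrA e.
Qed.

Lemma weight_fromE h (p : seq step) :
  weight_from h p =
  if stays_nonneg h p && (h%:Z + ycoord p (size p) == 0) then
    \prod_(i < size p) match nth Up p i with
      | Up => 1
      | Down => l `|(h%:Z + ycoord p i.+1)%R|%N
      | Horiz => b `|(h%:Z + ycoord p i.+1)%R|%N
      end
  else 0.
Proof.
elim: p h => [|s p IHp] h.
  rewrite /stays_nonneg /= ycoord0 addr0 lez_nat leq0n big_ord0 /= eqz_nat.
  by rewrite /unit0; case: eqP.
have step k : h%:Z + dy s = k%:Z ->
  (stays_nonneg h (s :: p) && (h%:Z + ycoord (s :: p) (size (s :: p)) == 0))
  = (stays_nonneg k p && (k%:Z + ycoord p (size p) == 0)).
  by move=> e; rewrite (@stays_nonneg_cons _ k) // /= ycoord_cons addrA e.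
have prodE k : h%:Z + dy s = k%:Z ->
  \prod_(i < size (s :: p)) match nth Up (s :: p) i with
      | Up => 1
      | Down => l `|(h%:Z + ycoord (s :: p) i.+1)%R|%N
      | Horiz => b `|(h%:Z + ycoord (s :: p) i.+1)%R|%N
      end = match s with Up => 1 | Down => l k | Horiz => b k end *
  \prod_(i < size p) match nth Up p i with
      | Up => 1
      | Down => l `|(k%:Z + ycoord p i.+1)%R|%N
      | Horiz => b `|(k%:Z + ycoord p i.+1)%R|%N
      end.
  move=> e; rewrite big_ord_recl /= ycoord_cons ycoord0 addr0 e absz_nat.
  by congr (_ * _); apply: eq_bigr => i _; rewrite /bump /= add1n ycoord_cons addrA e.
case: s step prodE => step prodE /=.
- rewrite (step h.+1) ?(prodE h.+1) ?IHp ?mul1r //=; lia.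
- case: h step prodE => [|h] step prodE /=.
    (* A down step from height 0 reaches -1, so both sides vanish. *)
    rewrite /stays_nonneg /= ycoord_cons !ycoord0 !addr0 /=.
    by [].
  rewrite (step h) ?(prodE h) ?IHp //=; try lia.
  by case: ifP => // _; rewrite mulr0.
- rewrite (step h) ?(prodE h) ?IHp //=; try lia.
  by case: ifP => // _; rewrite mulr0.
Qed.

Lemma Mot_jacobi n : Mot b l n = iter n (jacobi b l) (unit0 R) 0%N.
Proof.
rewrite -sum_weight_from /Mot big_mkcond /=; apply: eq_bigr => p _.
rewrite weight_fromE inE /is_motzkin size_tuple add0r.
have -> : stays_nonneg 0 p = [forall k : 'I_n.+1, 0 <= ycoord p k].
  apply/allP/forallP => [H k|H k].
    by have := H k; rewrite mem_iota size_tuple add0r ltn_ord; apply.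
  rewrite mem_iota size_tuple add0n add0r /= => ltk.
  exact: (H (Ordinal ltk)).
case: ifP => // _; rewrite /path_weight; apply: eq_bigr => i _.
by rewrite (tnth_nth Up) /step_height add0r.
Qed.

End MotzkinJacobi.

(** * Intertwining of the two tridiagonal operators *)

Lemma eq_jacobi (R : nzRingType) (b l v w : nat -> R) :
  v =1 w -> jacobi b l v =1 jacobi b l w.
Proof. by move=> e [|i]; rewrite /jacobi !e. Qed.

(* Its moments are the binomial transform of the Catalan numbers. *)
Definition catalan_jacobi : (nat -> rat) -> nat -> rat :=
  jacobi (fun i => if i is 0 then 2 else 3) (fun=> 1).

Section Darboux.
Variables b lambda : nat -> rat.
Hypotheses (hb0 : b 0%N = 1) (hlambda0 : lambda 0%N = 1).
Hypothesis hb : forall n : nat, (1 <= n)%N ->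
  b n = 3 - 1 / ((fibz (2 * n%:Z - 1))%:~R * (fibz (2 * n%:Z - 3))%:~R).
Hypothesis hlambda : forall n : nat, (1 <= n)%N ->
  lambda n = 1 + 1 / (fibz (2 * n%:Z - 1))%:~R ^+ 2.

(** Starting at F_(-1) = 1 makes the denominator of [b i.+1] the product of [oddfib i.+1] and
    [oddfib i]. *)
Definition oddfib (i : nat) : rat := (fibz (2 * i%:Z - 1))%:~R.

Lemma oddfib0 : oddfib 0 = 1. Proof. by []. Qed.
Lemma oddfib1 : oddfib 1 = 1. Proof. by []. Qed.

(** F_(m+4) = 2 F_(m+2) + F_(m+1), and F_(m+1) = F_(m+2) - F_m. *)
Lemma oddfibSS i : oddfib i.+2 = 3 * oddfib i.+1 - oddfib i.
Proof.
rewrite /oddfib.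
have e k : (fibz k)%:~R = (fibz (k - 1))%:~R + (fibz (k - 2))%:~R :> rat.
  by rewrite -intrD -fibz_rec.
set x := (2 * i%:Z - 1).
have -> : 2 * i.+2%:Z - 1 = x + 4 by rewrite /x; lia.
have -> : 2 * i.+1%:Z - 1 = x + 2 by rewrite /x; lia.
rewrite (e (x + 4)) (e (x + 4 - 1)).
have := e (x + 2).
have -> : x + 4 - 1 - 1 = x + 2 by lia.
have -> : x + 4 - 1 - 2 = x + 1 by lia.
have -> : x + 4 - 2 = x + 2 by lia.
have -> : x + 2 - 1 = x + 1 by lia.
have -> : x + 2 - 2 = x by lia.
lra.
Qed.

(** Monotonicity is carried along because the recurrence subtracts. *)
Lemma oddfib_gt0 i : 0 < oddfib i.
Proof.
suff: 0 < oddfib i /\ oddfib i <= oddfib i.+1 by case.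
elim: i => [|i [IH1 IH2]]; first by rewrite oddfib0 oddfib1.
rewrite oddfibSS; lra.
Qed.

(** The form x^2 + y^2 - 3xy is invariant under (x, y) -> (y, 3y - x) and equals -1 at (1, 1). *)
Lemma oddfib_cassini i :
  oddfib i.+1 ^+ 2 + oddfib i ^+ 2 + 1 = 3 * oddfib i * oddfib i.+1.
Proof.
elim: i => [|i IH]; first by rewrite oddfib0 oddfib1.
rewrite oddfibSS; lra.
Qed.

(** The matrix A. Its subdiagonal ratios send the vector u_i = (-1)^i F_(2i-1), which satisfies K u
    = e_0, to e_0. *)
Definition darboux (v : nat -> rat) (i : nat) : rat :=
  v i + (if i is j.+1 then oddfib j.+1 / oddfib j * v j else 0).

(** The identity J A = A K, row by row; the boundary entries make rows 0 and 1 separate cases. *)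
Lemma jacobi_darboux v :
  jacobi b lambda (darboux v) =1 darboux (catalan_jacobi v).
Proof.
have bS j : b j.+1 = 3 - 1 / (oddfib j.+1 * oddfib j).
  rewrite hb // /oddfib; congr (3 - 1 / (_ * (fibz _)%:~R)); lia.
have lS j : lambda j.+1 = 1 + 1 / oddfib j.+1 ^+ 2 by rewrite hlambda.
have nz j : oddfib j != 0 by rewrite lt0r_neq0 ?oddfib_gt0.
move=> [|[|i]]; rewrite /catalan_jacobi /darboux /jacobi.
- rewrite /= ?oddfib0 ?oddfib1 hb0. by field.
- rewrite /= bS oddfibSS !oddfib0 !oddfib1 hlambda0. by field.
- rewrite !bS !lS.
  have := oddfib_cassini i; have := nz i; have := nz i.+1; have := nz i.+2.
  rewrite !oddfibSS; set x := oddfib i; set y := oddfib i.+1.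
  set z := 3 * y - x => nzz nzy nzx cassini.
  (* Coefficients of [v i.+2], [v i] and [v i.+1] in turn. The first two use the Cassini relation as
     y (3z - y) = z^2 + 1 and x z = y^2 + 1. *)
  have d2E : (3 * z - y) / z = 3 + z / y - (3 - 1 / (z * y)).
    have -> : 3 * z - y = (z ^+ 2 + 1) / y.
      by apply: (mulIf nzy); rewrite divfK // /z; lra.
    by field; rewrite nzz nzy.
  have d1E : z / y = (1 + 1 / y ^+ 2) * (y / x).
    have -> : z = (y ^+ 2 + 1) / x.
      by apply: (mulIf nzx); rewrite divfK // /z; lra.
    by field; rewrite nzx nzy.
  have d0E : (3 - 1 / (z * y)) * (z / y) = 3 * (z / y) - 1 / y ^+ 2.
    by field; rewrite nzz nzy.
  rewrite d2E; move: d1E d0E.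
  move: (z / y) (y / x) (3 - 1 / (z * y)) (1 / y ^+ 2) => d1 d0 c e d1E d0E.
  rewrite [c * _]mulrDr [c * (d1 * _)]mulrA d0E d1E; ring.
Qed.

(** One power of J turns e_0 into A e_0, which accounts for the shift; row 0 of A is that of the
    identity. *)
Lemma Mot_catalan n : Mot b lambda n.+1 = iter n catalan_jacobi (unit0 rat) 0%N.
Proof.
rewrite Mot_jacobi iterSr.
have init : jacobi b lambda (unit0 rat) =1 darboux (unit0 rat).
  by move=> [|[|i]]; rewrite /jacobi /darboux /unit0 /= ?hb0 ?hlambda0 ?oddfib0
    ?oddfib1 ?mulr0 ?addr0 ?add0r.
suff H : iter n (jacobi b lambda) (jacobi b lambda (unit0 rat))
    =1 darboux (iter n catalan_jacobi (unit0 rat)).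
  by rewrite H /darboux addr0.
elim: n => [|n IHn] //= i.
by rewrite (eq_jacobi _ _ IHn) jacobi_darboux.
Qed.

End Darboux.

(** * Counting predecessor sequences *)

Section PredecessorSequences.
Local Open Scope nat_scope.

(* [keeps c a b]: the arc [(a, c)] still allows [b < c] to be the left end of a
   later arc; [a = c] encodes the absence of an arc ending in [c]. *)
Definition keeps (c a b : nat) : bool :=
  (a == c) || ((b != a) && ~~ ((a < b) && (b.+1 < c))).

(** Entry [i] is [i] itself when [i] opens a block, and otherwise an earlier position that no arc
    ending before [i] excludes. *)
Definition valid (x : seq nat) : bool :=
  all (fun i => (nth 0 x i <= i) &&
         ((nth 0 x i == i) ||
           all (fun j => keeps j (nth 0 x j) (nth 0 x i)) (iota 0 i)))
      (iota 0 (size x)).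

(** The earlier positions that the next entry may name. *)
Definition live (x : seq nat) : seq nat :=
  [seq b <- iota 0 (size x) |
    all (fun j => keeps j (nth 0 x j) b) (iota 0 (size x))].

Lemma iota_rcons m : iota 0 m.+1 = rcons (iota 0 m) m.
Proof. by rewrite -addn1 iotaD cats1. Qed.

Lemma all_keeps_rcons x a b m : m <= size x ->
  all (fun j => keeps j (nth 0 (rcons x a) j) b) (iota 0 m)
  = all (fun j => keeps j (nth 0 x j) b) (iota 0 m).
Proof.
move=> le; apply: eq_in_all => j; rewrite mem_iota => /andP[_ ltj].
by rewrite nth_rcons (leq_trans ltj).
Qed.

Lemma valid_rcons x a :
  valid (rcons x a) = valid x && ((a == size x) || (a \in live x)).
Proof.
rewrite {1}/valid size_rcons iota_rcons all_rcons andbC; congr (_ && _).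
  apply: eq_in_all => i; rewrite mem_iota => /andP[_ lti].
  by rewrite nth_rcons lti all_keeps_rcons // ltnW.
rewrite nth_rcons ltnn eqxx all_keeps_rcons // mem_filter mem_iota /= andbC.
by case: ltngtP => //=; rewrite ?andbT ?andbF.
Qed.

Lemma valid_catl x y : valid (x ++ y) -> valid x.
Proof.
elim/last_ind: y => [|y a IH]; first by rewrite cats0.
by rewrite -rcons_cat valid_rcons => /andP[/IH].
Qed.

(** An arc ending no later than a position cannot exclude it, so the new position is live; the older
    ones must survive the new arc. *)
Lemma live_rcons x a : a <= size x -> valid x ->
  live (rcons x a) =
  rcons [seq b <- live x | keeps (size x) a b] (size x).
Proof.
move=> lea vx; rewrite /live size_rcons iota_rcons filter_rcons -filter_predI.
have -> : all (fun j => keeps j (nth 0 (rcons x a) j) (size x))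
    (rcons (iota 0 (size x)) (size x)).
  rewrite all_rcons all_keeps_rcons // nth_rcons ltnn eqxx; apply/andP; split.
    by rewrite /keeps; case: eqP => //=; case: (ltngtP a) lea; lia.
  apply/allP => j jx; have := allP vx _ jx; move: jx.
  rewrite mem_iota /keeps => lt /andP[le _]; apply/orP; right; lia.
congr rcons; apply: eq_filter => b.
by rewrite /= all_rcons all_keeps_rcons // nth_rcons ltnn eqxx.
Qed.

Lemma live_sorted x : sorted ltn (live x).
Proof. exact: sorted_filter ltn_trans _ _ (iota_ltn_sorted _ _). Qed.

(* Number of ways to append [m] further entries when [j.+1] positions are
   live. *)
Fixpoint completions (m j : nat) : nat :=
  if m is p.+1 then
    completions p j.+1 + completions p j + \sum_(i < j) completions p i.+1
  else 1.

(** Turns a sum over live positions into a sum over ranks: the entry at index [k] has [k] smaller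
    entries. *)
Lemma size_filter_ltn (l : seq nat) : sorted ltn l ->
  [seq size [seq b <- l | b < a] | a <- l] = iota 0 (size l).
Proof.
elim/last_ind: l => // l c IH sl.
have sl' : sorted ltn l by move: sl; rewrite -cats1 => /cat_sorted2[].
have lt_c b : b \in l -> b < c.
  move=> bl; move: sl; rewrite sorted_pairwise; last exact: ltn_trans.
  by rewrite pairwise_rcons => /andP[/allP H _]; apply: H.
rewrite size_rcons iota_rcons map_rcons filter_rcons ltnn; congr rcons.
  rewrite -IH //; apply/eq_in_map => a al.
  by rewrite filter_rcons ltnNge (ltnW (lt_c _ al)).
by congr size; apply/all_filterP/allP.
Qed.

Lemma live_last x c : valid (rcons x c) ->
  exists2 l, live (rcons x c) = rcons l (size x) & all (ltn^~ (size x)) l.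
Proof.
rewrite valid_rcons => /andP[vx cx].
have lec : c <= size x.
  case/orP: cx => [/eqP-> //|]; rewrite mem_filter mem_iota => /and3P[_ _]; apply: ltnW.
rewrite live_rcons //; eexists; first by [].
by apply/allP => b; rewrite !mem_filter mem_iota => /and4P[].
Qed.

Lemma sum_ord_mem (N : nat) (l : seq nat) (F : nat -> nat) :
  uniq l -> all (ltn^~ N) l ->
  \sum_(a < N) (if (a : nat) \in l then F a else 0) = \sum_(a <- l) F a.
Proof.
move=> ul /allP lN.
rewrite -[LHS]big_mkcond /= -(big_mkord (fun a => a \in l)) /= /index_iota subn0.
rewrite -big_filter; apply: perm_big; apply: uniq_perm => //.
  by rewrite filter_uniq // iota_uniq.
move=> a; rewrite mem_filter mem_iota /= andbC.
by case: (boolP (a \in l)) => [/lN|]; rewrite ?andbF ?andbT.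
Qed.

(** Splitting by the next entry [a], at position [s], gives the three terms of [completions]. *)
Lemma completionsP (N m : nat) x : valid x -> 0 < size x -> size x + m <= N ->
  \sum_(t : m.-tuple 'I_N) valid (x ++ map val t)
    = completions m (size (live x)).-1.
Proof.
elim: m x => [|m IHm] x vx x0 leN.
  rewrite (eq_bigr (fun=> 1)) => [|t _]; last by rewrite tuple0 cats0 vx.
  by rewrite sum1_card card_tuple expn0.
rewrite (sum_tuple_cons _ (fun t => nat_of_bool (valid (x ++ map val t)))).
set s := size x.
have [l' lx l's] : exists2 l, live x = rcons l s.-1 & all (ltn^~ s.-1) l.
  rewrite /s; case/lastP: x vx @s x0 {leN} => // x c vx _.
  by rewrite size_rcons => _; apply: live_last.
have sl' : sorted ltn l'.
  by have := live_sorted x; rewrite lx -cats1 => /cat_sorted2[].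
have ul : uniq (s :: live x).
  rewrite /= (sorted_uniq ltn_trans ltnn (live_sorted x)) andbT.
  by rewrite mem_filter mem_iota ltnn !andbF.
(* Position [s] becomes live too, so the size of the filtered list is already the new live count
   minus one. *)
have step (a : 'I_N) :
  \sum_(t : m.-tuple 'I_N) valid (x ++ map val (a :: t))
  = if val a \in s :: live x then
      completions m (size [seq b <- live x | keeps s a b]) else 0.
  have E (t : m.-tuple 'I_N) : x ++ map val (a :: t) = rcons x a ++ map val t.
    by rewrite cat_rcons.
  under eq_bigr => t _ do rewrite E.
  rewrite inE; case: ifP => H.
    have les : a <= s.
      by case/orP: H => [/eqP->//|]; rewrite mem_filter mem_iota => /and3P[_ _ /ltnW].
    rewrite IHm ?size_rcons ?addSnnS //; last by rewrite valid_rcons vx H.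
    by rewrite live_rcons // size_rcons.
  apply: big1 => t _; case: (boolP (valid _)) => // /valid_catl.
  by rewrite valid_rcons H andbF.
under eq_bigr => a _ do rewrite step.
have -> : (\sum_(a : 'I_N)
     (if val a \in s :: live x then
        completions m (size [seq b <- live x | keeps s a b]) else 0))%R =
  \sum_(a <- s :: live x) completions m (size [seq b <- live x | keeps s a b]).
  apply: (sum_ord_mem (fun a => completions m (size [seq b <- live x | keeps s a b]))) => //.
  apply/allP => a; rewrite inE => /orP[/eqP->|] /=.
    lia.
  rewrite mem_filter mem_iota -/s; lia.
rewrite big_cons lx size_rcons /= big_rcons /= -addnA.
have flt b : b \in l' -> b < s.-1 by move/(allP l's).
congr (completions m _ + _).
  (* [a = s] opens a block and excludes nothing. *)
  by rewrite (eq_filter (a2 := xpredT)) ?filter_predT ?size_rcons // => b;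
    rewrite /keeps eqxx.
(* [a = s.-1] excludes only itself. *)
rewrite addnC; congr (completions m _ + _).
  rewrite filter_rcons {1}/keeps eqxx (_ : s.-1 == s = false) /=; last lia.
  congr size; apply/all_filterP/allP => b /flt ltb; rewrite /keeps; lia.
(* An older [a] leaves the smaller live positions and [s.-1], which lies too close to [s] to be
   excluded. *)
rewrite -(big_mkord xpredT (fun i => completions m i.+1)) /index_iota subn0.
rewrite -(size_filter_ltn sl') big_map; apply: eq_big_seq => a al.
congr completions; rewrite filter_rcons {1}/keeps.
have lta := flt a al.
rewrite (_ : (a == s) || _); last by lia.
rewrite size_rcons; congr _.+1; congr size; apply: eq_in_filter => b /flt ltb.
rewrite /keeps; lia.
Qed.

Lemma sum_valid n :
  \sum_(t : n.+1.-tuple 'I_n.+1) valid (map val t) = completions n 0.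
Proof.
rewrite (sum_tuple_cons _ (fun t : seq 'I_n.+1 => nat_of_bool (valid (map val t)))).
(* The first entry must be 0, leaving one live position. *)
rewrite big_ord_recl /= (completionsP (x := [:: 0])) // [X in (_ + X)%R]big1 ?addr0 //.
by move=> i _; apply: big1.
Qed.

End PredecessorSequences.

Local Notation arc := Defs.arc.

(** * Set partitions and their predecessor functions *)

Section Partition.
Local Open Scope nat_scope.
Variable n : nat.
Implicit Types P Q : {set {set 'I_n}}.

Lemma arcP P (i j : 'I_n) : partition P [set: 'I_n] ->
  reflect [/\ i < j, j \in pblock P i
            & forall k : 'I_n, k \in pblock P i -> i < k < j -> False]
          (arc P i j).
Proof.
move=> pP; have [/eqP covP trivP _] := and3P pP.
have iP k : k \in cover P by rewrite covP inE.
rewrite /arc; apply: (iffP andP).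
  case=> lt /existsP[B /and4P[BP iB jB /forallP H]]; split=> //.
    by rewrite (def_pblock trivP BP iB).
  move=> k; rewrite (def_pblock trivP BP iB) => kB ltk.
  by have := H k; rewrite kB ltk.
case=> lt jB H; split=> //; apply/existsP; exists (pblock P i).
rewrite pblock_mem // mem_pblock iP jB /=.
by apply/forallP => k; apply/implyP => kB; apply/negP; apply: H.
Qed.

Arguments arcP {P i j}.

Lemma same_sym P (i j : 'I_n) : partition P [set: 'I_n] ->
  j \in pblock P i -> i \in pblock P j.
Proof.
move=> pP; have [/eqP covP trivP _] := and3P pP.
move=> jB; rewrite (same_pblock trivP jB) mem_pblock covP inE //.
Qed.

Lemma same_trans P (i j k : 'I_n) : partition P [set: 'I_n] ->
  j \in pblock P i -> k \in pblock P i -> k \in pblock P j.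
Proof.
move=> pP; have [/eqP covP trivP _] := and3P pP.
by move=> jB; rewrite (same_pblock trivP jB).
Qed.

Lemma arc_injl P (i i' j : 'I_n) : partition P [set: 'I_n] ->
  arc P i j -> arc P i' j -> i = i'.
Proof.
move=> pP /(arcP pP)[lt s H] /(arcP pP)[lt' s' H'].
have si := same_sym pP s; have si' := same_sym pP s'.
have ss : i' \in pblock P i by apply: (same_trans pP si).
apply: val_inj => /=; case: (ltngtP i i') => // ltii.
  by case: (H i'); rewrite // ltii.
by case: (H' i); rewrite ?ltii // (same_sym pP).
Qed.

Lemma arc_injr P (i j j' : 'I_n) : partition P [set: 'I_n] ->
  arc P i j -> arc P i j' -> j = j'.
Proof.
move=> pP /(arcP pP)[lt s H] /(arcP pP)[lt' s' H'].
apply: val_inj => /=; case: (ltngtP j j') => // ltjj.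
  by case: (H' j); rewrite // lt.
by case: (H j'); rewrite // lt'.
Qed.

(** The left end is the largest element of the block below [j]. *)
Lemma arc_exists P (i j : 'I_n) : partition P [set: 'I_n] ->
  i < j -> j \in pblock P i ->
  exists2 k : 'I_n, k \in pblock P i & arc P k j.
Proof.
move=> pP lt s.
have iP k : k \in pblock P k.
  by have [/eqP covP _ _] := and3P pP; rewrite mem_pblock covP inE.
have Pi : (i < j) && (i \in pblock P i) by rewrite lt iP.
have := @arg_maxnP _ i (fun k : 'I_n => (k < j) && (k \in pblock P i)) val Pi.
case=> k /andP[ltk sk] kmax; exists k => //.
apply/(arcP pP); split=> //; first exact: same_trans sk s.
move=> m sm /andP[km mj].
have: m <= k by apply: kmax; rewrite mj (same_trans pP (same_sym pP sk)).
by rewrite leqNgt km.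
Qed.

(* Positions that start a block point to themselves. *)
Definition arc_pred P (j : 'I_n) : 'I_n := odflt j [pick i | arc P i j].

Lemma arc_predP P (i j : 'I_n) : partition P [set: 'I_n] ->
  arc P i j = (arc_pred P j == i) && (i < j).
Proof.
move=> pP; rewrite /arc_pred; case: pickP => [k akj|noarc] /=.
  apply/idP/andP => [aij|[/eqP<-] //].
  by rewrite (arc_injl pP aij akj) eqxx; split=> //; case/(arcP pP): akj.
by rewrite noarc; case: eqP => //= ->; rewrite ltnn.
Qed.

Lemma arc_pred_le P (j : 'I_n) : partition P [set: 'I_n] -> arc_pred P j <= j.
Proof.
move=> pP; rewrite /arc_pred; case: pickP => //= k /(arcP pP)[lt _ _].
exact: ltnW.
Qed.

Lemma same_arc_pred P (i j : 'I_n) : partition P [set: 'I_n] -> i < j ->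
  (j \in pblock P i) = (arc_pred P j < j) && (arc_pred P j \in pblock P i).
Proof.
move=> pP lt; apply/idP/andP => [s|[ltp s]].
  have [k sk] := arc_exists pP lt s.
  by rewrite (arc_predP _ _ pP) => /andP[/eqP-> ->].
have: arc P (arc_pred P j) j by rewrite (arc_predP _ _ pP) eqxx.
by case/(arcP pP) => _ s' _; exact: same_trans pP (same_sym pP s) s'.
Qed.

(** By [same_arc_pred], induction on a bound for the larger element recovers the relation of lying
    in one block, and with it the blocks. *)
Lemma arc_pred_inj P Q : partition P [set: 'I_n] -> partition Q [set: 'I_n] ->
  arc_pred P =1 arc_pred Q -> P = Q.
Proof.
move=> pP pQ e.
have lts m (i j : 'I_n) : i < j -> j < m ->
    (j \in pblock P i) = (j \in pblock Q i).
  elim: m i j => [|m IHm] i j // ltij ltj.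
  rewrite (same_arc_pred pP) // (same_arc_pred pQ) // -e.
  case: ltnP => //= ltp; have ltpm : arc_pred P j < m by apply: leq_trans ltp _.
  case: (ltngtP i (arc_pred P j)) => [lt|lt|eqi].
  - exact: IHm.
  - have ltim : i < m by apply: leq_trans ltij _.
    by apply/idP/idP => /same_sym s; apply: same_sym => //;
       [rewrite -IHm //|rewrite IHm //]; apply: s.
  - have <- : i = arc_pred P j by apply: val_inj.
    have [/eqP covP _ _] := and3P pP; have [/eqP covQ _ _] := and3P pQ.
    by rewrite !mem_pblock covP covQ.
have s i j : (j \in pblock P i) = (j \in pblock Q i).
  case: (ltngtP i j) => [lt|lt|eqi].
  - exact: (lts n).
  - by apply/idP/idP => /same_sym s; apply: same_sym => //;
       [rewrite -(lts n) //|rewrite (lts n) //]; apply: s.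
  - have <- : i = j by apply: val_inj.
    have [/eqP covP _ _] := and3P pP; have [/eqP covQ _ _] := and3P pQ.
    by rewrite !mem_pblock covP covQ.
have pe i : pblock P i = pblock Q i by apply/setP => j; rewrite s.
have sub A B : partition A [set: 'I_n] -> partition B [set: 'I_n] ->
    pblock A =1 pblock B -> A \subset B.
  move=> pA pB eAB; have [/eqP covA trivA n0A] := and3P pA.
  have [/eqP covB trivB _] := and3P pB.
  apply/subsetP => X XA; have /set0Pn[x xX] : X != set0.
    by apply: contraNneq n0A => <-.
  by rewrite -(def_pblock trivA XA xX) eAB pblock_mem // covB inE.
by apply/eqP; rewrite eqEsubset !sub // => i; rewrite pe.
Qed.

(** * Recovering a partition from a predecessor function *)

Section FromPred.
Variable f : 'I_n -> 'I_n.
Hypothesis f_le : forall i, f i <= i.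
Hypothesis f_inj : forall i j, f i < i -> f j < j -> f i = f j -> i = j.

(** Each iteration descends or has stopped, so [n] of them reach a fixed point, the least element of
    the block. *)
Definition root (i : 'I_n) : 'I_n := iter n f i.

Lemma root_fix i : f (root i) = root i.
Proof.
suff H m : f (iter m f i) = iter m f i \/ iter m f i + m <= i.
  case: (H n) => // leq_i; have := leq_trans (leq_addl _ _) leq_i.
  by rewrite leqNgt ltn_ord.
elim: m => [|m [IH|IH]]; first by right; rewrite addn0.
  by left; rewrite iterS !IH.
rewrite iterS; have := f_le (iter m f i); rewrite leq_eqVlt => /orP[/eqP e|lt].
  by left; have E : f (iter m f i) = iter m f i; [apply: val_inj|rewrite !E].
by right; lia.
Qed.

Lemma root_pred i : root (f i) = root i.
Proof. by rewrite /root -iterSr iterS root_fix. Qed.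

Lemma root_le i : root i <= i.
Proof.
suff H m : iter m f i <= i by apply: H.
by elim: m => //= m IHm; apply: leq_trans (f_le _) IHm.
Qed.

Lemma root_id i : f i = i -> root i = i.
Proof. move=> e; suff H m : iter m f i = i by apply: H.
by elim: m => //= m ->. Qed.

(** Injectivity forbids two chains to merge, so the chain descending from [j] passes through [i].
    The induction compares [i] with [f j]. *)
Lemma same_root_succ i j : root i = root j -> i < j ->
  exists k : 'I_n, [/\ i < k, k <= j & f k = i].
Proof.
have [m] := ubnP j; elim: m i j => // m IHm i j ltjm e lt.
have := f_le j; rewrite leq_eqVlt => /orP[/eqP ej|ltf].
  have rj : root j = j by apply: root_id; apply: val_inj.
  by have := root_le i; rewrite e rj leqNgt lt.
case: (ltngtP i (f j)) => [ltif|ltfi|eqi].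
- have [k [k1 k2 k3]] : exists k : 'I_n, [/\ i < k, k <= f j & f k = i].
    by apply: IHm => //; [apply: leq_trans ltf _|rewrite root_pred].
  by exists k; split=> //; apply: leq_trans k2 (ltnW ltf).
- have [k [k1 k2 k3]] : exists k : 'I_n, [/\ f j < k, k <= i & f k = f j].
    by apply: IHm => //; [apply: leq_trans lt _|rewrite root_pred].
  have ekj : k = j by apply: f_inj; rewrite ?k3.
  by move: k2; rewrite ekj leqNgt lt.
- by exists j; split=> //; apply: val_inj.
Qed.

Definition pred_partition : {set {set 'I_n}} :=
  preim_partition root [set: 'I_n].

Lemma pred_partitionP : partition pred_partition [set: 'I_n].
Proof. exact: preim_partitionP. Qed.

Lemma same_pred_partition i j :
  (j \in pblock pred_partition i) = (root i == root j).
Proof.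
rewrite pblock_equivalence_partition ?inE //.
by split=> // /eqP->.
Qed.

(** An element after [i] in its block is at or beyond a successor of [i], which injectivity makes
    unique. *)
Lemma arc_pred_partition i j : arc pred_partition i j = (f j == i) && (i < j).
Proof.
apply/(arcP pred_partitionP)/andP => [[lt s H]|[/eqP e lt]].
  split=> //; move: s; rewrite same_pred_partition => /eqP s.
  have [k [k1 k2 k3]] := same_root_succ s lt.
  move: k2; rewrite leq_eqVlt => /orP[/eqP ekj|k2].
    by have <- : k = j; [apply: val_inj|apply/eqP].
  case: (H k); last by rewrite k1.
  by rewrite same_pred_partition -k3 root_pred.
split=> //; first by rewrite same_pred_partition -e root_pred.
move=> k; rewrite same_pred_partition => /eqP s /andP[ik kj].
have [g [g1 g2 g3]] := same_root_succ s ik.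
have egj : g = j by apply: f_inj; rewrite ?g3 ?e.
by move: g2; rewrite egj leqNgt kj.
Qed.

Lemma arc_pred_pred_partition : arc_pred pred_partition =1 f.
Proof.
move=> j; have := f_le j; rewrite leq_eqVlt => /orP[/eqP e|lt].
  rewrite /arc_pred; case: pickP => [k|_] /=; last by apply/esym/val_inj.
  by rewrite arc_pred_partition => /andP[/eqP].
have: arc pred_partition (f j) j by rewrite arc_pred_partition eqxx.
by rewrite (arc_predP _ _ pred_partitionP) => /andP[/eqP].
Qed.

End FromPred.

(** * Noncrossing partitions against valid sequences *)

Lemma nth_val (t : n.-tuple 'I_n) (i : 'I_n) : nth 0 (map val t) i = tnth t i.
Proof. by rewrite (nth_map i) ?size_tuple // -tnth_nth. Qed.

(** Separates what [keeps] combines: no shared left ends, and no forbidden crossing, where [i] and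
    [j] are the right ends c and d. *)
Lemma valid_tupleP (t : n.-tuple 'I_n) :
  reflect [/\ forall i, tnth t i <= i,
              forall i j, tnth t i < i -> tnth t j < j -> tnth t i = tnth t j -> i = j
            & forall i j, tnth t i < i -> tnth t j < j -> i < j ->
                tnth t i < tnth t j -> (tnth t j).+1 < i -> False]
          (valid (map val t)).
Proof.
rewrite /valid size_map size_tuple; apply: (iffP allP) => [H|[le inj nc] i].
  have H' (i : 'I_n) : (tnth t i <= i) && ((val (tnth t i) == i) ||
      all (fun j => keeps j (nth 0 (map val t) j) (tnth t i)) (iota 0 i)).
    by have := H i; rewrite mem_iota ltn_ord nth_val; apply.
  have K (i j : 'I_n) : tnth t i < i -> tnth t j < j -> i < j ->
      keeps i (tnth t i) (tnth t j).
    move=> lti ltj lt; have /andP[_ /orP[/eqP e|/allP A]] := H' j.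
      by move: ltj; rewrite e ltnn.
    by have := A i; rewrite mem_iota nth_val; apply.
  split.
  - by move=> i; have /andP[] := H' i.
  - move=> i j lti ltj e; apply: val_inj => /=.
    case: (ltngtP i j) => // lt.
      have := K i j lti ltj lt; rewrite /keeps e eqxx /= orbF.
      by rewrite -e => /eqP e'; move: lti; rewrite e' ltnn.
    have := K j i ltj lti lt; rewrite /keeps e eqxx /= orbF.
    by move=> /eqP e'; move: ltj; rewrite e' ltnn.
  - move=> i j lti ltj lt l1 l2; have := K i j lti ltj lt.
    by rewrite /keeps l1 l2 andbF orbF => /eqP e; move: lti; rewrite e ltnn.
rewrite mem_iota add0n => /= lti.
rewrite -[i]/(val (Ordinal lti)); move: (Ordinal lti) => {lti}i.
rewrite nth_val le /=; case: eqP => //= ne.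
have {}lti : tnth t i < i by rewrite ltn_neqAle le andbT; apply/eqP.
apply/allP => j; rewrite mem_iota add0n /= => ltj.
have ltjn : j < n by apply: ltn_trans ltj _.
move: ltj; rewrite -[j]/(val (Ordinal ltjn)); move: (Ordinal ltjn) => {ltjn}j ltji.
rewrite nth_val /keeps; case: eqP => //= ne'.
have {}ltj : tnth t j < j by rewrite ltn_neqAle le andbT; apply/eqP.
apply/andP; split.
  apply/eqP => e; have eij : i = j by apply: inj => //; apply: val_inj.
  by move: ltji; rewrite eij ltnn.
apply/negP => /andP[l1 l2]; exact: nc ltj lti ltji l1 l2.
Qed.

Lemma noncrossing2P P (f : 'I_n -> 'I_n) :
  (forall i j, arc P i j = (f j == i) && (i < j)) ->
  reflect (forall i j : 'I_n, f i < i -> f j < j -> i < j ->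
             f i < f j -> (f j).+1 < i -> False)
          (noncrossing2 P).
Proof.
move=> arcE; apply: (iffP negP) => [H i j lti ltj lt l1 l2|H].
  apply: H; apply/existsP; exists (f i); apply/existsP; exists (f j).
  apply/existsP; exists i; apply/existsP; exists j.
  rewrite !arcE !eqxx lti ltj l1 lt /=; apply/andP; split; lia.
case/existsP=> a /existsP[b /existsP[c /existsP[d]]].
rewrite !arcE => /and5P[/andP[/eqP e1 l1] /andP[/eqP e2 l2] l3 l4 /andP[l5 l6]].
apply: (H c d); rewrite ?e1 ?e2 //; lia.
Qed.

(** Two injections give two inequalities: a partition goes to its predecessor tuple, a valid tuple
    to its partition into chains. *)
Lemma card_NC2 : #|NC2 n| = \sum_(t : n.-tuple 'I_n) valid (map val t).
Proof.
have -> : \sum_(t : n.-tuple 'I_n) valid (map val t)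
    = #|[set t : n.-tuple 'I_n | valid (map val t)]|.
  rewrite -sum1dep_card [RHS]big_mkcond /=.
  by apply: eq_bigr => t _; case: (valid _).
apply/eqP; rewrite eqn_leq; apply/andP; split.
  have inj : {in NC2 n &, injective (fun P => [tuple arc_pred P i | i < n])}.
    move=> P Q; rewrite !inE => /andP[pP _] /andP[pQ _] e.
    apply: arc_pred_inj => // i.
    by have := congr1 (fun t => tnth t i) e; rewrite /= !tnth_mktuple.
  rewrite -(card_in_imset inj); apply/subset_leq_card/subsetP => _ /imsetP[P PN ->].
  move: PN; rewrite !inE => /andP[pP nc]; apply/valid_tupleP; split.
  - by move=> i; rewrite tnth_mktuple arc_pred_le.
  - move=> i j; rewrite !tnth_mktuple => lti ltj e.
    by apply: (@arc_injr P (arc_pred P i)) => //; rewrite arc_predP // ?e eqxx // -e.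
  - move=> i j; rewrite !tnth_mktuple; apply/(@noncrossing2P P) => //.
    by move=> *; apply: arc_predP.
have inj : {in [set t : n.-tuple 'I_n | valid (map val t)] &,
              injective (fun t => pred_partition (tnth t))}.
  move=> t u; rewrite !inE => /valid_tupleP[t1 t2 _] /valid_tupleP[u1 u2 _] e.
  apply: eq_from_tnth => i.
  by rewrite -(arc_pred_pred_partition t1 t2) e (arc_pred_pred_partition u1 u2).
rewrite -(card_in_imset inj); apply/subset_leq_card/subsetP => _ /imsetP[t tv ->].
move: tv; rewrite !inE pred_partitionP => /valid_tupleP[t1 t2 t3] /=.
by apply/(@noncrossing2P _ (tnth t)) => // i j; apply: arc_pred_partition.
Qed.

End Partition.

(** * Conjugation by the binomial transform *)

(* [\sum_h 'C(j, h) * v h], by Pascal's rule. *)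
Fixpoint binomial_transform (j : nat) (v : nat -> rat) : rat :=
  if j is i.+1 then
    binomial_transform i v + binomial_transform i (fun h => v h.+1)
  else v 0%N.

Lemma eq_binomial_transform j v w :
  v =1 w -> binomial_transform j v = binomial_transform j w.
Proof.
elim: j v w => [|j IH] v w e /=; first exact: e.
by congr (_ + _); apply: IH => // h.
Qed.

Lemma binomial_transformD j v w :
  binomial_transform j (fun h => v h + w h)
  = binomial_transform j v + binomial_transform j w.
Proof. by elim: j v w => [|j IH] v w //=; rewrite !IH addrACA. Qed.

(** Induction on [j]. With S the shift, Pascal's rule adds the transform of S K v = (1 + S)^2 v + S
    v, and the right side grows by the same amount. *)
Lemma binomial_transform_catalan j v :
  binomial_transform j (catalan_jacobi v)
  = binomial_transform j.+1 v + binomial_transform j v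
    + \sum_(i < j) binomial_transform i.+1 v.
Proof.
elim: j => [|j IH]; first by rewrite big_ord0 /catalan_jacobi /jacobi /=; ring.
have e : (fun h => catalan_jacobi v h.+1) =1 (fun h => v h.+2 + (v h.+1 + (v h.+1 + (v h.+1 + v h)))).
  by move=> h; rewrite /catalan_jacobi /jacobi; ring.
rewrite [LHS]/= IH (eq_binomial_transform _ e) !binomial_transformD.
rewrite [in RHS]big_ord_recr /=; ring.
Qed.

(** For [j = 0] this makes [completions m 0] the (0, 0) entry of K^m. *)
Lemma completions_catalan m j :
  (completions m j)%:R
  = binomial_transform j (iter m catalan_jacobi (unit0 rat)).
Proof.
elim: m j => [|m IH] j.
  (* Only [h = 0] contributes to the transform of e_0, which is therefore 1 for every [j]. *)
  have z i : binomial_transform i (fun h => unit0 rat h.+1) = 0.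
    rewrite (@eq_binomial_transform _ _ (fun=> 0)) //.
    by elim: i => //= i ->; rewrite addr0.
  by elim: j => //= j <-; rewrite z addr0.
by rewrite [iter _ _ _]/= binomial_transform_catalan -!IH !natrD natr_sum;
  under [in RHS]eq_bigr => i _ do rewrite -IH.
Qed.

Theorem theorem1p1 (b lambda : nat -> rat)
  (hb0 : b 0%N = 1) (hlambda0 : lambda 0%N = 1)
  (hb : forall n : nat, (1 <= n)%N ->
     b n = 3 - 1 / ((fibz (2 * n%:Z - 1))%:~R * (fibz (2 * n%:Z - 3))%:~R))
  (hlambda : forall n : nat, (1 <= n)%N ->
     lambda n = 1 + 1 / (fibz (2 * n%:Z - 1))%:~R ^+ 2)
  (n : nat) :
  #|NC2 n|%:R = Mot b lambda n.
Proof.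
rewrite card_NC2; case: n => [|n].
  (* Length 0 lies outside the shift of [Mot_catalan]; both sides are 1. *)
  rewrite (eq_bigr (fun=> 1%N)) => [|t _]; last by rewrite tuple0.
  by rewrite sum1_card card_tuple Mot_jacobi.
by rewrite sum_valid completions_catalan Mot_catalan.
Qed.
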